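(* Let $\mathscr{H}(K)$ be a reproducing kernel Hilbert space on $X$, let $\mu$ be a probability measure on $X$, and let $M>0$. Suppose the target function $g:X\to\mathbb{F}$ and the cost function $c:\mathbb{F}\times\mathbb{F}\to\mathbb{R}^+$ are such that $c(0,g(\cdot))\in L^1(X,\mu)$ and, for any given $z\in\mathbb{F}$, $c(\cdot,z)$ is lower semicontinuous. Then the problem $$\inf_{f\in\mathscr{H}(K)} \int_X c(f(x),g(x))\,d\mu(x)\quad\text{such that}\quad \|f\|_{\mathscr{H}(K)}\le M$$ admits an optimizer $\hat f\in\mathscr{H}(K)$. Furthermore, when $c(f(x),g(x))=|f(x)-g(x)|^p$ with $p>1$, the optimizer is unique.
   Context: $\mathbb{F}=\mathbb{R}$ or $\mathbb{C}$, and $\mathbb{R}^+=[0,\infty)$ is the set of nonnegative real numbers. A reproducing kernel Hilbert space (RKHS) on $X$ is a vector subspace $\mathscr{H}$ of the space of all functions $X\to\mathbb{F}$ equipped with a Hilbert space inner product $\langle\cdot,\cdot\rangle$ ($\mathbb{F}$-linear in the first argument) such that each evaluation functional $f\mapsto f(x)$, $x\in X$, is bounded. For $x\in X$, $k_x\in\mathscr{H}$ is the unique vector with $f(x)=\langle f,k_x\rangle$ for all $f\in\mathscr{H}$; the reproducing kernel is $K(y,x)=k_x(y)$, and $\mathscr{H}(K)$ denotes the RKHS with reproducing kernel $K$. Standing assumptions: $X$ is a Polish space, and all functions and measures are Borel measurable. An optimizer is an element $\hat f\in\mathscr{H}(K)$ with $\|\hat f\|_{\mathscr{H}(K)}\le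 M$ attaining the infimum.
   Formalization: Uniqueness of the optimizer is proved only up to equality μ-almost everywhere; as elements of H(K) it fails, e.g. X={0,1}, H(K)=l²(X), μ=δ₀, g=0, M=1, p=2, where every f with f(0)=0 and |f(1)|≤1 is an optimizer. *)

(* Defs.v *)
From HB Require Import structures.
From mathcomp Require Import all_boot all_order all_algebra complex.
From mathcomp Require Import sesquilinear.
From mathcomp Require Import all_classical all_reals all_analysis.

Set Implicit Arguments.
Unset Strict Implicit.
Unset Printing Implicit Defensive.

Import Order.TTheory GRing.Theory Num.Theory.
Import numFieldNormedType.Exports.

Local Open Scope classical_set_scope.
Local Open Scope ring_scope.

Variant scalar_kind := real_scalars | complex_scalars.

Definition RorC (R : realType) (k : scalar_kind) : numFieldType :=
  match k with real_scalars => R | complex_scalars => R[i] end.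

Definition sconj (R : realType) (k : scalar_kind) :
    {rmorphism RorC R k -> RorC R k} :=
  match k return {rmorphism RorC R k -> RorC R k} with
  | real_scalars => idfun
  | complex_scalars => @conjc R
  end.

Definition sre (R : realType) (k : scalar_kind) : RorC R k -> R :=
  match k return RorC R k -> R with
  | real_scalars => id
  | complex_scalars => @complex.Re R
  end.

(* The library norm of z is itself a scalar; [sre] brings it back to R. *)
Definition modulus (R : realType) (k : scalar_kind) (z : RorC R k) : R :=
  sre `|z|.

Definition polish (R : realType) (X : topologicalType) :=
  (exists2 D : set X, countable D & dense D) /\
  exists d : X -> X -> R,
    [/\ (forall x y, d x y = 0 <-> x = y),
        (forall x y, d x y = d y x),
        (forall x y z, d x z <= d x y + d y z),
        (forall (x : X) (A : set X),
           nbhs x A <-> exists2 e : R, 0 < e & [set y | d x y < e] `<=` A) &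
        (forall u : nat -> X,
           (forall e : R, 0 < e -> exists N : nat, forall m n : nat,
              (N <= m)%N -> (N <= n)%N -> d (u m) (u n) < e) ->
           exists x : X, u @ \oo --> x)].

(* Missing join of the library's pointed and topological structures on pairs. *)
HB.instance Definition _ (T U : ptopologicalType) := Pointed.on (T * U)%type.

Notation borel T := (g_sigma_algebraType (@open T)).

Definition borel_measurable (T U : ptopologicalType) (f : T -> U) :=
  measurable_fun setT (f : borel T -> borel U).

Section Linsub.
Variables (F : pzRingType) (V : lmodType F) (S : submodClosed V).

Record linsub := Linsub { linsub_val :> V; _ : linsub_val \in S }.

HB.instance Definition _ := [isSub for linsub_val].
HB.instance Definition _ := [Choice of linsub by <:].
HB.instance Definition _ := [SubChoice_isSubLmodule of linsub by <:].

End Linsub.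

Section HilbertNorm.
Variables (R : realType) (k : scalar_kind) (V : lmodType (RorC R k)).
Variable form : {dot V for sconj R k}.

Definition dot_norm (f : V) : R := Num.sqrt (sre (form f f)).

Definition dot_complete :=
  forall u : nat -> V,
    (forall e : R, 0 < e -> exists N : nat, forall m n : nat,
       (N <= m)%N -> (N <= n)%N -> dot_norm (u m - u n) < e) ->
    exists l : V, dot_norm (u n - l) @[n --> \oo] --> (0 : R).

End HilbertNorm.

(* [{dot V for sconj}] is linear in its first argument and [sconj]-linear in
   the second one. The codomain is [F^o], the scalar field F seen as a module
   over itself, so that the functions form a vector space over F. *)
Record rkhs (R : realType) (k : scalar_kind) (X : Type) := RKHS {
  rkhs_sub : submodClosed (X -> (RorC R k)^o);
  rkhs_dot : {dot linsub rkhs_sub for sconj R k};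
  rkhs_complete : dot_complete rkhs_dot;
  rkhs_eval_bounded : forall x : X, exists C : R,
    forall f : linsub rkhs_sub, modulus (linsub_val f x) <= C * dot_norm rkhs_dot f
}.

Section RKHSTheory.
Variables (R : realType) (k : scalar_kind).
Local Notation F := (RorC R k).

Definition rkhs_space (X : Type) (H : rkhs R k X) : lmodType F :=
  linsub (rkhs_sub H).

Definition rkhs_fun (X : Type) (H : rkhs R k X) (f : rkhs_space H) : X -> F :=
  linsub_val f.

Definition rkhs_norm (X : Type) (H : rkhs R k X) (f : rkhs_space H) : R :=
  dot_norm (rkhs_dot H) f.

Definition reproducing_kernel (X : Type) (H : rkhs R k X) (K : X -> X -> F) :=
  forall x : X, exists2 kx : rkhs_space H,
    (forall y, rkhs_fun kx y = K y x) &
    (forall f : rkhs_space H, rkhs_fun f x = rkhs_dot H f kx).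

Variables (X : ptopologicalType) (mu : probability (borel X) R).
Variables (c : F -> F -> R) (g : X -> F).

Definition risk (f : X -> F) : \bar R := (\int[mu]_x (c (f x) (g x))%:E)%E.

Definition optimizer (H : rkhs R k X) (M : R) (f : rkhs_space H) :=
  rkhs_norm f <= M /\
  risk (rkhs_fun f) =
    ereal_inf [set risk (rkhs_fun h) |
                 h in [set h : rkhs_space H | rkhs_norm h <= M]].

End RKHSTheory.

(* Main.v *)
Require Import Defs.
From HB Require Import structures.
From mathcomp Require Import all_boot all_order all_algebra complex.
From mathcomp Require Import sesquilinear.
From mathcomp Require Import all_classical all_reals all_analysis.
From mathcomp Require Import measurable_realfun.
From mathcomp Require Import ring lra.

(* Existence is the direct method: a minimizing sequence in the ball of radius M
   has a weakly convergent subsequence, weak convergence in an RKHS implies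
   pointwise convergence, and lower semicontinuity of c with Fatou's lemma shows
   that the weak limit is optimal. Complex scalars are avoided by viewing H as a
   real Hilbert space for the real part of its inner product. For uniqueness,
   |z|^p is strictly convex, so the midpoint of two optimizers would have a
   smaller risk unless they agree mu-almost everywhere. *)

Set Implicit Arguments.
Unset Strict Implicit.
Unset Printing Implicit Defensive.

Import Order.TTheory GRing.Theory Num.Theory.
Import numFieldNormedType.Exports.

Local Open Scope classical_set_scope.
Local Open Scope ring_scope.

(** * Diagonal extraction of subsequences *)

(** By Tychonoff's theorem the rows [a n] live in a compact product of segments, hence have a
    cluster point [l]. Increasing indices are picked one after the other, each approximating [l] on
    a longer initial block of coordinates. *)
Lemma diagonal_subsequence (R : realType) (a : nat -> nat -> R) (C : nat -> R) :
  (forall n j, `|a n j| <= C j) ->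
  exists2 s : nat -> nat, {homo s : m n / (m < n)%N} &
    forall j, cvgn (fun n => a (s n) j).
Proof.
move=> aC.
have cpt := @tychonoff nat (fun=> R) (fun j => `[- C j, C j]%classic)
  (fun j => @segment_compact R _ _).
have [] := cpt (a @ \oo) (fmap_proper_filter _ _).
  by exists 0%N => // n _ j /=; rewrite in_itv /= -ler_norml.
move=> l [_ lcl].
have pick N k : exists n, (N < n)%N /\
    forall j, (j <= k)%N -> `|l j - a n j| < k.+1%:R^-1.
  have inftyN : (a @ \oo) [set a n | n in [set n | (N < n)%N]].
    by exists N.+1 => // n /= Nn; exists n.
  have nbl : nbhs l
      [set f : nat -> R | forall j : 'I_k.+1, `|l j - f j| < k.+1%:R^-1].
    apply: (filter_forall (F := nbhs l)) => j.
    have k0 : (0 : R) < k.+1%:R^-1 by rewrite invr_gt0.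
    exact: (@proj_continuous nat (fun=> R) j l _ (nbhsx_ballx (l j) _ k0)).
  have [_ [[n /= Nn <-] an]] := lcl _ _ inftyN nbl.
  by exists n; split=> // j jk; exact: (an (Ordinal (jk : (j < k.+1)%N))).
pose p N k := sval (cid (pick N k)).
have pP N k : _ := svalP (cid (pick N k)).
pose s := fix s n := if n is m.+1 then p (s m) n else p 0%N 0%N.
exists s.
  apply: homo_ltn; first exact: ltn_trans.
  by move=> n; exact: (pP (s n) n.+1).1.
(* The row [s n] is within 1/(n+1) of [l] on the coordinates up to [n], so coordinate [j] is
   controlled as soon as [n >= j]. *)
move=> j; apply/cvg_ex; exists (l j); apply/cvgrPdist_lt => e e0.
have /= := near_infty_natSinv_lt (PosNum e0).
apply: filterS2 (nbhs_infty_ge j) => -[|n] jn; apply: lt_trans;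
  exact: (pP _ _).2 jn.
Qed.

(** * Weak sequential compactness in a real Hilbert space *)

(* [act] stands for the real scalars, so that the theory also applies to a
   Hilbert space over C, with the real part of its inner product. *)
Section RealHilbert.
Variables (R : realType) (V : zmodType) (act : R -> V -> V) (ip : V -> V -> R).
Hypothesis ipDl : forall u v w, ip (u + v) w = ip u w + ip v w.
Hypothesis ipZl : forall a u w, ip (act a u) w = a * ip u w.
Hypothesis ipC : forall u v, ip u v = ip v u.
Hypothesis ip_ge0 : forall u, 0 <= ip u u.

Lemma ip0l w : ip 0 w = 0.
Proof. by apply: (addrI (ip 0 w)); rewrite -ipDl !addr0. Qed.

Lemma ipNl u w : ip (- u) w = - ip u w.
Proof. by apply: (addrI (ip u w)); rewrite -ipDl !subrr ip0l. Qed.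

Lemma ipDr w u v : ip w (u + v) = ip w u + ip w v.
Proof. by rewrite ipC ipDl !(ipC w). Qed.

Lemma ipZr w a u : ip w (act a u) = a * ip w u.
Proof. by rewrite ipC ipZl (ipC w). Qed.

Lemma ipNr w u : ip w (- u) = - ip w u.
Proof. by rewrite ipC ipNl (ipC w). Qed.

Lemma ip_cauchy_schwarz u v : ip u v ^+ 2 <= ip u u * ip v v.
Proof.
have pos t : 0 <= ip u u + t * (2 * ip u v) + t ^+ 2 * ip v v.
  have := ip_ge0 (u + act t v).
  by rewrite !(ipDl, ipDr, ipZl, ipZr) (ipC v u); congr (_ <= _); ring.
have := ip_ge0 v; rewrite le_eqVlt => /predU1P[v0|v0].
  have [-> |uv0] := eqVneq (ip u v) 0; first by rewrite expr0n /= -v0 mulr0.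
  (* For [ip v v = 0] the quadratic polynomial of [pos] is affine in [t], and this [t] would give it
     the value -1. *)
  have := pos (- (ip u u + 1) / (2 * ip u v)).
  have -> : - (ip u u + 1) / (2 * ip u v) * (2 * ip u v) = - (ip u u + 1).
    by rewrite divfK// mulf_neq0.
  by rewrite -v0; lra.
(* The minimizer of the quadratic polynomial. *)
have := pos (- ip u v / ip v v).
have -> : ip u u + - ip u v / ip v v * (2 * ip u v) +
    (- ip u v / ip v v) ^+ 2 * ip v v = (ip u u * ip v v - ip u v ^+ 2) / ip v v.
  by field; rewrite gt_eqF.
by rewrite pmulr_lge0 ?invr_gt0// subr_ge0.
Qed.

Lemma ip_double_le u v : 2 * ip u v <= ip u u + ip v v.
Proof.
have := ip_ge0 (u - v); rewrite !(ipDl, ipDr, ipNl, ipNr) (ipC v u).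
by move=> ?; lra.
Qed.

Lemma ip_cvg (u : nat -> V) l h :
  ip (u n - l) (u n - l) @[n --> \oo] --> (0 : R) ->
  ip (u n) h @[n --> \oo] --> ip l h.
Proof.
move=> ul; have /cvgrPdist_lt ul' := ul.
apply/cvgrPdist_lt => e e0.
(* The added 1 keeps the divisor positive when [ip h h = 0]. *)
have q0 : 0 < ip h h + 1 by rewrite ltr_wpDl.
have e20 : 0 < e ^+ 2 / (ip h h + 1) by rewrite divr_gt0// exprn_gt0.
apply: filterS (ul' _ e20) => n; rewrite sub0r normrN ger0_norm// => lt.
rewrite -(ltr_pXn2r (ltn0Sn 1)) ?nnegrE// ?(ltW e0)// real_normK ?num_real//.
have -> : ip l h - ip (u n) h = - ip (u n - l) h by rewrite ipDl ipNl; ring.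
rewrite sqrrN; apply: le_lt_trans (ip_cauchy_schwarz _ _) _.
move: lt; rewrite ltr_pdivlMr//; apply: le_lt_trans.
by rewrite ler_wpM2l//; lra.
Qed.

Hypothesis ip_complete : forall u : nat -> V,
  (forall e : R, 0 < e -> exists N : nat, forall m n : nat,
     (N <= m)%N -> (N <= n)%N -> ip (u m - u n) (u m - u n) < e) ->
  exists l, ip (u n - l) (u n - l) @[n --> \oo] --> (0 : R).

(* The representer is the limit of a minimizing sequence of
   [v |-> ip v v - 2 * L v] on S, which is Cauchy by the parallelogram law. *)
Lemma riesz_on (S : set V) (L : V -> R) (B : R) :
  S 0 -> (forall u v, S u -> S v -> S (u + v)) ->
  (forall a u, S u -> S (act a u)) ->
  (forall u v, S u -> S v -> L (u + v) = L u + L v) ->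
  (forall a u, S u -> L (act a u) = a * L u) ->
  (forall u, S u -> 2 * L u <= ip u u + B) ->
  exists (l : V) (v : nat -> V), [/\ forall n, S (v n),
    ip (v n - l) (v n - l) @[n --> \oo] --> (0 : R) &
    forall u, S u -> ip l u = L u].
Proof.
move=> S0 SD SZ LD LZ LB.
pose J v := ip v v - 2 * L v.
pose A := J @` S.
have infA : has_inf A.
  split; first by exists (J 0), 0.
  by exists (- B) => _ [v Sv <-]; rewrite /J; move: (LB _ Sv); lra.
have AJ v : S v -> inf A <= J v.
  by move=> Sv; apply: (ge_inf infA.2); exists v.
have /choice[v vP] : forall n, exists v, S v /\ J v < inf A + n.+1%:R^-1.
  move=> n; have n0 : (0 : R) < n.+1%:R^-1 by rewrite invr_gt0.
  by have [_ [v Sv <-] lt] := inf_adherent n0 infA; exists v.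
have Sv n : S (v n) := (vP n).1.
have [l vl] : exists l, ip (v n - l) (v n - l) @[n --> \oo] --> (0 : R).
  apply: ip_complete => e e0.
  have e40 : 0 < e / 4 by rewrite divr_gt0.
  have [N _ NP] := near_infty_natSinv_lt (PosNum e40).
  exists N => m n /NP /= me /NP /= ne.
  (* The midpoint of [v m] and [v n] is in [S], so [J] is at least [inf A] there. As J (v m) + J (v
     n) minus twice this value is half the squared distance, that squared distance is below 2
     (1/(m+1) + 1/(n+1)) < e. *)
  have := AJ _ (SZ 2^-1 _ (SD _ _ (Sv m) (Sv n))).
  rewrite /J LZ ?LD//; last exact: SD.
  rewrite !(ipDl, ipDr, ipZl, ipZr, ipNl, ipNr) (ipC (v n) (v m)).
  move: (vP m).2 (vP n).2 me ne; rewrite /J.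
  by move: (m.+1%:R^-1) (n.+1%:R^-1) => x y; lra.
exists l, v; split=> // u Su.
(* First variation: [J (v n + t u)] is at least [inf A], hence exceeds [J (v n)] - 1/(n+1); then [n]
   tends to infinity. *)
have pos t : 0 <= 2 * t * (ip l u - L u) + t ^+ 2 * ip u u.
  have cv : n.+1%:R^-1 + 2 * t * (ip (v n) u - L u) + t ^+ 2 * ip u u
      @[n --> \oo] --> 0 + 2 * t * (ip l u - L u) + t ^+ 2 * ip u u.
    apply: cvgD; last exact: cvg_cst.
    apply: cvgD; first exact: cvg_harmonic.
    apply: cvgM; first exact: cvg_cst.
    by apply: cvgB; [exact: ip_cvg|exact: cvg_cst].
  rewrite -[2 * t * _]add0r -(cvg_lim (@Rhausdorff R) cv).
  apply: limr_ge; [exact: cvgP cv|apply: nearW => n].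
  have := AJ _ (SD _ _ (Sv n) (SZ t _ Su)); have := (vP n).2.
  rewrite /J LD ?LZ//; last exact: SZ.
  rewrite !(ipDl, ipDr, ipZl, ipZr) (ipC u (v n)).
  by move: (n.+1%:R^-1) => x; rewrite expr2; lra.
have q0 : 0 < ip u u + 1 by rewrite ltr_wpDl.
apply/eqP; rewrite -subr_eq0; apply/negPn/negP => d0.
(* This [t] makes the variation strictly negative unless [ip l u = L u]; the 1 covers the case
   [ip u u = 0]. *)
have := pos (- (ip l u - L u) / (ip u u + 1)).
set d := ip l u - L u in d0 *.
have -> : 2 * (- d / (ip u u + 1)) * d + (- d / (ip u u + 1)) ^+ 2 * ip u u =
   - (d / (ip u u + 1)) ^+ 2 * (ip u u + 2) by field; rewrite gt_eqF.
rewrite mulNr oppr_ge0 leNgt mulr_gt0//; last by rewrite ltr_wpDl.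
by rewrite exprn_even_gt0// mulf_neq0// invr_neq0// gt_eqF.
Qed.

(** A diagonal subsequence has convergent products with every [u j]. The vectors with convergent
    products form a subspace [S], which turns out to be the whole space. The limit is then a bounded
    linear functional, and its representer is the weak limit. *)
Lemma weak_sequential_compactness (u : nat -> V) (C : R) :
  (forall n, ip (u n) (u n) <= C) ->
  exists (s : nat -> nat) (l : V), [/\ {homo s : m n / (m < n)%N}, ip l l <= C &
    forall h, ip (u (s n)) h @[n --> \oo] --> ip l h].
Proof.
move=> uC.
have [|s sinc scv] :=
  @diagonal_subsequence R (fun n j => ip (u n) (u j)) (fun=> C).
  move=> n j; have CC : `|ip (u n) (u j)| <= C.
    have C0 : 0 <= C by apply: le_trans (uC 0%N).
    rewrite -(ler_pXn2r (ltn0Sn 1)) ?nnegrE// real_normK ?num_real//.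
    apply: le_trans (ip_cauchy_schwarz _ _) _.
    by rewrite expr2 ler_pM.
  exact: CC.
pose S := [set h | cvgn (fun n => ip (u (s n)) h)].
have SD h h' : S h -> S h' -> S (h + h').
  by rewrite /S/= => Sh Sh'; under eq_fun do rewrite ipDr; exact: is_cvgD.
have SZ a h : S h -> S (act a h).
  by rewrite /S/= => Sh; under eq_fun do rewrite ipZr; exact: is_cvgMr.
have S0 : S 0.
  by rewrite /S/=; under eq_fun do rewrite ipC ip0l; exact: is_cvg_cst.
(* S is closed, contains every u n, and the projection onto S of an arbitrary h
   has the same products with the u n as h. *)
have ST h : S h.
  have [|||l [v [Sv vl lP]]] :=
    @riesz_on S (fun w => ip w h) (ip h h) S0 SD SZ _ _ _.
  - by move=> *; exact: ipDl.
  - by move=> *; exact: ipZl.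
  - by move=> w _; exact: ip_double_le.
  have hl : (fun n => ip (u (s n)) h) = (fun n => ip (u (s n)) l).
    by apply/funext => n; rewrite -lP ?(ipC l)//; exact: scv.
  (* By Cauchy-Schwarz and the bound [C], replacing [l] by a close [v k] in [S] changes the products
     by less than e/2 uniformly in [n]. The limit of the products with [v k] is thus the centre
     required by the Cauchy criterion. *)
  rewrite /S/= hl; apply/cauchy_cvgP/cauchy_exP => e e0.
  have C0 : 0 < C + 1 by rewrite ltr_wpDl// (le_trans _ (uC 0%N)).
  have e2 : 0 < (e / 2) ^+ 2 / (C + 1).
    by rewrite divr_gt0// exprn_gt0// divr_gt0.
  have /cvgrPdist_lt /(_ _ e2) [k _ /(_ k (leqnn k)) /=] := vl.
  rewrite sub0r normrN ger0_norm// => vk.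
  exists (limn (fun n => ip (u (s n)) (v k))).
  have /cvgrPdist_lt /(_ (e / 2)) := Sv k.
  have e20 : 0 < e / 2 by rewrite divr_gt0.
  move=> /(_ e20); apply: filterS => n; rewrite /ball/= => lt.
  have lt2 : `|ip (u (s n)) (v k - l)| < e / 2.
    rewrite -(ltr_pXn2r (ltn0Sn 1)) ?nnegrE// ?(ltW e20)//.
    rewrite real_normK ?num_real//.
    apply: le_lt_trans (ip_cauchy_schwarz _ _) _.
    move: vk; rewrite ltr_pdivlMr// mulrC; apply: le_lt_trans.
    by rewrite ler_wpM2r// (le_trans (uC _))// lerDl.
  have -> : limn (fun n => ip (u (s n)) (v k)) - ip (u (s n)) l =
     (limn (fun n => ip (u (s n)) (v k)) - ip (u (s n)) (v k)) +
     ip (u (s n)) (v k - l) by rewrite ipDr ipNr; ring.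
  by rewrite (le_lt_trans (ler_normD _ _))// [e]splitr ltrD.
pose L h := limn (fun n => ip (u (s n)) h).
have cvL h : ip (u (s n)) h @[n --> \oo] --> L h by exact: ST.
(* This is the boundedness that [riesz_on] asks for; taken at the representer [l] itself, it also
   yields [ip l l <= C]. *)
have L_le h : 2 * L h <= ip h h + C.
  have cv : 2 * ip (u (s n)) h @[n --> \oo] --> 2 * L h.
    by apply: cvgM => //; exact: cvg_cst.
  rewrite -(cvg_lim (@Rhausdorff R) cv); apply: limr_le; first exact: cvgP cv.
  apply: nearW => n; have := ip_double_le (u (s n)) h.
  by have := uC (s n); lra.
have [] := @riesz_on setT L C; try by [].
- move=> h h' _ _; apply/cvg_lim => //; under eq_fun do rewrite ipDr.
  exact: cvgD.
- move=> a h _; apply/cvg_lim => //; under eq_fun do rewrite ipZr.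
  by apply: cvgM => //; exact: cvg_cst.
move=> l [_ [_ _ lP]]; exists s, l; split=> //.
- by have := L_le l; rewrite -lP//; lra.
- by move=> h; rewrite lP.
Qed.

End RealHilbert.

(** * Real and complex scalars, and Borel measurability *)

Definition sinj (R : realType) (k : scalar_kind) : R -> RorC R k :=
  match k return R -> RorC R k with
  | real_scalars => id
  | complex_scalars => fun a => a%:C%C
  end.

(* [sre (simu k * z)] is the imaginary part of z (0 for real scalars). *)
Definition simu (R : realType) (k : scalar_kind) : RorC R k :=
  match k return RorC R k with
  | real_scalars => 0
  | complex_scalars => (- 'i)%C
  end.

Lemma borel_measurableP (T U : ptopologicalType) (f : T -> U) :
  borel_measurable f <->
  forall A : set U, open A -> measurable (f @^-1` A : set (borel T)).
Proof.
split=> [mf A oA|mf].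
  by rewrite -[_ @^-1` _]setTI; apply: mf => //; exact: sub_sigma_algebra.
refine (@measurability _ _ (borel T) (borel U) setT f (@open U) _ _) => //.
by move=> _ [A oA <-]; rewrite setTI; exact: mf.
Qed.

Section Scalars.
Variables (R : realType) (k : scalar_kind).
Local Notation F := (RorC R k).
Implicit Types (z w : F) (a b e : R).

Lemma sreD z w : sre (z + w) = sre z + sre w.
Proof. by case: k z w => //= -[? ?] [? ?]. Qed.

Lemma sreN z : sre (- z) = - sre z.
Proof. by case: k z => //= -[? ?]. Qed.

Lemma sre_conj z : sre (sconj R k z) = sre z.
Proof. by case: k z => //= -[? ?]. Qed.

Lemma sreM a z : sre (sinj k a * z) = a * sre z.
Proof. by case: k z => //= -[? ?] /=; rewrite mul0r subr0. Qed.

Lemma sre_inj a : sre (sinj k a) = a.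
Proof. by case: k. Qed.

Lemma sre_ge0 z : 0 <= z -> 0 <= sre z.
Proof. by case: k z => //= -[? ?] /=; rewrite lecE/= => /andP[]. Qed.

Lemma sinjD a b : sinj k (a + b) = sinj k a + sinj k b.
Proof. by case: k => //=; rewrite rmorphD. Qed.

Lemma ltr_sinj a b : (sinj k a < sinj k b) = (a < b).
Proof. by case: k => //=; rewrite ltcR. Qed.

Lemma sinj0 : sinj k (0 : R) = 0.
Proof. by case: k. Qed.

Lemma sinj_sre_gt0 z : 0 < z -> z = sinj k (sre z).
Proof. by case: k z => //= -[? ?] /=; rewrite ltcE/= => /andP[/eqP-> _]. Qed.

Lemma normr_modulus z : `|z| = sinj k (modulus z).
Proof. by case: k z. Qed.

Lemma modulus_ge0 z : 0 <= modulus z.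
Proof. exact: sre_ge0. Qed.

Lemma modulus0_eq0 z : modulus z = 0 -> z = 0.
Proof.
by move=> z0; apply/eqP; rewrite -normr_eq0 normr_modulus z0 sinj0 eqxx.
Qed.

Lemma modulusD z w : modulus (z + w) <= modulus z + modulus w.
Proof.
rewrite leNgt -ltr_sinj sinjD -!normr_modulus; apply/negP => lt.
by have := le_lt_trans (ler_normD z w) lt; rewrite ltxx.
Qed.

Lemma modulusN z : modulus (- z) = modulus z.
Proof. by rewrite /modulus normrN. Qed.

Lemma modulusM a z : 0 <= a -> modulus (sinj k a * z) = a * modulus z.
Proof.
move=> a0; rewrite /modulus normrM.
have -> : `|sinj k a| = sinj k a.
  by apply/ger0_norm; rewrite -sinj0; case: k => //=; rewrite lecR.
by rewrite sreM.
Qed.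

Lemma modulus_sqr z : modulus z ^+ 2 = sre z ^+ 2 + sre (simu R k * z) ^+ 2.
Proof.
rewrite /modulus; case: k z => /= [z|[x y]].
  by rewrite mul0r expr0n addr0 /= real_normK ?num_real.
rewrite sqr_sqrtr ?addr_ge0 ?sqr_ge0//=; congr (_ + _ ^+ 2).
by rewrite oppr0 mul0r mulN1r opprK add0r.
Qed.

Lemma modulus_parallelogram z w :
  modulus (z + w) ^+ 2 + modulus (z - w) ^+ 2 =
  2 * (modulus z ^+ 2 + modulus w ^+ 2).
Proof.
by rewrite !modulus_sqr !mulrDr !sreD mulrN !sreN; ring.
Qed.

Lemma modulus_le z : modulus z <= `|sre z| + `|sre (simu R k * z)|.
Proof.
rewrite -(ler_pXn2r (ltn0Sn 1)) ?nnegrE ?modulus_ge0 ?addr_ge0//.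
rewrite modulus_sqr sqrrD !real_normK ?num_real//.
by rewrite addrAC lerDl mulrn_wge0// mulr_ge0.
Qed.

(** The balls of [F] have radii in [F]. A positive scalar is necessarily real, so real radii
    describe the same topology. *)
Lemma nbhs_modulusP z (A : set F) :
  nbhs z A <-> exists2 e : R, 0 < e & [set w | modulus (z - w) < e] `<=` A.
Proof.
split => [/nbhs_ballP[e /= e0 eA]|[e e0 eA]].
  have es := sinj_sre_gt0 e0.
  exists (sre e); first by rewrite -ltr_sinj -es sinj0.
  by move=> w /= we; apply: eA; rewrite /ball/= normr_modulus es ltr_sinj.
apply/nbhs_ballP; exists (sinj k e); first by rewrite /= -sinj0 ltr_sinj.
by move=> w; rewrite /ball/= normr_modulus ltr_sinj; exact: eA.
Qed.

Lemma open_modulus_ball z e : open [set w : F | modulus (z - w) < e].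
Proof.
have -> : [set w : F | modulus (z - w) < e] = ball z (sinj k e).
  by apply/seteqP; split => w; rewrite /ball/= normr_modulus ltr_sinj.
exact: ball_open.
Qed.

(** As [simu] is -i over the complex numbers, this is the point q.1 + i q.2; over the reals it is
    q.1. *)
Definition dense_seq (q : rat * rat) : F :=
  sinj k (ratr q.1) - simu R k * sinj k (ratr q.2).

Lemma dense_seqP z e : 0 < e -> exists q, modulus (z - dense_seq q) < e.
Proof.
move=> e0.
have rat_near a : exists q : rat, `|a - ratr q| < e / 2.
  have /rat_in_itvoo[q] : a - e / 2 < a + e / 2 by lra.
  rewrite in_itv/= => /andP[? ?]; exists q.
  by rewrite ltr_norml; apply/andP; split; lra.
have [q1 q1P] := rat_near (sre z).
have [q2 q2P] := rat_near (sre (simu R k * z)).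
have sre_simu : sre (simu R k) = 0 by case: (k) => //=; rewrite oppr0.
exists (q1, q2); apply: le_lt_trans (modulus_le _) _.
rewrite [ltRHS]splitr /dense_seq/=.
rewrite opprB addrA mulrDr !mulrDr !sreD mulrN !sreN.
rewrite (mulrC (simu R k) (sinj k _)) (mulrC (simu R k) (sinj k (ratr q1))).
rewrite mulrCA !sreM sre_simu !mulr0 addr0 subr0 sre_inj ltrD//.
apply: le_lt_trans q2P; move: z {q1P rat_near sre_simu}.
case: (k) => /= [z|[x y]].
  by rewrite !mul0r mulr0 addr0 normr0.
by rewrite !(oppr0, mul0r, mulr0, sub0r, mulN1r, opprK, add0r, mulrN, mulr1).
Qed.

(** The Borel sets of the product are generated by all its open sets. Since [F] is separable, each
    of these is a countable union of products of balls with centres in [dense_seq] and radii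
    1/(n+1). *)
Lemma borel_measurable_pair (X : ptopologicalType) (f g : X -> F) :
  borel_measurable f -> borel_measurable g ->
  borel_measurable (fun x => (f x, g x)).
Proof.
move=> /borel_measurableP mf /borel_measurableP mg.
apply/borel_measurableP => U oU.
pose I := ((rat * rat) * (rat * rat) * nat)%type.
pose D (q : rat * rat) (n : nat) :=
  [set w : F | modulus (dense_seq q - w) < n.+1%:R^-1].
have oD q n : open (D q n) by exact: open_modulus_ball.
pose box (i : I) := D i.1.1 i.2 `*` D i.1.2 i.2.
(* The first factor is everything or empty: it discards the boxes not contained in [U] while keeping
   the index set countable. *)
pose P (i : I) : set (borel X) :=
  [set x | box i `<=` U] `&` (f @^-1` D i.1.1 i.2 `&` g @^-1` D i.1.2 i.2).
have -> : (fun x => (f x, g x)) @^-1` U = \bigcup_i P i.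
  apply/seteqP; split => [x /= Ux|x [i _ [/= iU fgx]]]; last exact: iU.
  have : nbhs (f x, g x) U by exact: open_nbhs_nbhs.
  move=> [[A B] /= [/nbhs_modulusP[a a0 aA] /nbhs_modulusP[b b0 bB]] ABU].
  (* Halved because the triangle inequality passes through the centre of the small ball. *)
  have ab0 : 0 < Num.min a b / 2 by rewrite divr_gt0// lt_min a0.
  have [n _ /(_ n (leqnn n)) /= nab] := near_infty_natSinv_lt (PosNum ab0).
  have n0 : (0 : R) < n.+1%:R^-1 by rewrite invr_gt0.
  have [q1 q1P] := dense_seqP (f x) n0.
  have [q2 q2P] := dense_seqP (g x) n0.
  have close z q w : modulus (z - dense_seq q) < n.+1%:R^-1 ->
      modulus (dense_seq q - w) < n.+1%:R^-1 -> modulus (z - w) < Num.min a b.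
    move=> zq qw; rewrite -(subrKA (dense_seq q)).
    rewrite (le_lt_trans (modulusD _ _))// [ltRHS]splitr.
    by rewrite ltrD// (lt_trans _ nab).
  exists (q1, q2, n) => //; split => /=.
    move=> [z w] [/= /(close _ _ _ q1P) zfx /(close _ _ _ q2P) wgx].
    apply: ABU; split; [apply: aA|apply: bB] => /=.
      by rewrite (lt_le_trans zfx)// ge_min lexx.
    by rewrite (lt_le_trans wgx)// ge_min lexx orbT.
  by split; rewrite /D/= -modulusN opprB.
apply: countable_bigcupT_measurable; first exact: countableP.
move=> i; apply: measurableI.
  have [iU|niU] := pselect (box i `<=` U).
    by rewrite (_ : [set x | _] = setT)//; apply/seteqP; split.
  by rewrite (_ : [set x | _] = set0)//; apply/seteqP; split.
by apply: measurableI; [exact: mf|exact: mg].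
Qed.

End Scalars.

(** Passes from the sigma-algebra generated by the open sets of [R] to the one used for integration,
    which open intervals generate. *)
Lemma borel_measurable_fun (R : realType) (X : ptopologicalType) (h : X -> R) :
  borel_measurable h -> measurable_fun setT (h : borel X -> R).
Proof.
move=> /borel_measurableP mh.
apply: (measurability _ (RGenOpens.measurableE R)) => _ [_ [a [b ->]] <-].
by rewrite setTI; apply: mh; exact: interval_open.
Qed.

(** * Strict convexity of powers of the modulus *)

(* With x = exp y, this combines the tangent line of exp at y, evaluated at p y
   and at 0. *)
Lemma powR_gt_tangent (R : realType) (p x : R) :
  1 < p -> 0 <= x -> x != 1 -> 1 + p * (x - 1) < x `^ p.
Proof.
move=> p1; rewrite le_eqVlt => /predU1P[<- _|x0 x1].
  by rewrite powR0 ?sub0r ?mulrN1; [lra|rewrite gt_eqF// (lt_trans ltr01)].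
pose y := ln x; have xE : x = expR y by rewrite /y lnK.
have y0 : y != 0 by apply: contra_neq x1; rewrite xE => ->; rewrite expR0.
have -> : x `^ p = expR (y * (p - 1)) * x.
  by rewrite /powR gt_eqF// -/y [X in _ = _ * X]xE -expRD; congr expR; ring.
have A1 : 1 + y * (p - 1) < expR (y * (p - 1)).
  by apply: expR_gt1Dx; rewrite mulf_neq0// subr_eq0 gt_eqF.
have A2 : 1 - y < x^-1.
  by rewrite xE -expRN expR_gt1Dx// oppr_eq0.
have A1' : (1 + y * (p - 1)) * x < expR (y * (p - 1)) * x by rewrite ltr_pM2r.
have A2' : (1 - y) * x < 1 by rewrite -[ltRHS](mulVf (lt0r_neq0 x0)) ltr_pM2r.
apply: le_lt_trans A1'.
have : (p - 1) * ((1 - y) * x) < (p - 1) * 1 by rewrite ltr_pM2l// subr_gt0.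
by lra.
Qed.

(** After division by the mean [m], both numbers differ from 1 and sum to 2. Adding the two tangent
    inequalities at 1 cancels the linear terms. *)
Lemma powR_midpoint_lt (R : realType) (p s t : R) :
  1 < p -> 0 <= s -> 0 <= t -> s != t ->
  2 * ((s + t) / 2) `^ p < s `^ p + t `^ p.
Proof.
move=> p1 s0 t0 st; set m := (s + t) / 2.
have m0 : 0 < m.
  rewrite divr_gt0// lt_def addr_ge0// andbT paddr_eq0//.
  by apply: contra st => /andP[/eqP-> /eqP->].
have mE : m *+ 2 = s + t by rewrite -mulr_natr /m divfK.
clearbody m.
have split_m x : 0 <= x -> x `^ p = (x / m) `^ p * m `^ p.
  move=> x0; rewrite -powRM ?(ltW m0)//; first by rewrite divfK// gt_eqF.
  exact: divr_ge0 (ltW m0).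
rewrite (split_m s)// (split_m t)// -mulrDl ltr_pM2r ?powR_gt0//.
have e : s / m + t / m = 2 by rewrite -mulrDl -mE -mulr_natl mulfK// gt_eqF.
have sm1 : s / m != 1.
  apply: contra st => /eqP s1; have t1 : t / m = 1 by lra.
  by rewrite -(divfK (lt0r_neq0 m0) s) s1 -t1 divfK// gt_eqF.
have tm1 : t / m != 1.
  by apply: contra sm1 => /eqP t1; apply/eqP; lra.
have := powR_gt_tangent p1 (divr_ge0 s0 (ltW m0)) sm1.
have := powR_gt_tangent p1 (divr_ge0 t0 (ltW m0)) tm1.
have -> : t / m = 2 - s / m by lra.
by lra.
Qed.

Section ModulusPowR.
Variables (R : realType) (k : scalar_kind) (p : R).
Hypothesis p1 : 1 < p.
Implicit Types z w : RorC R k.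

Let half (x : R) : (x + x) / 2 = x.
Proof. by field. Qed.

Lemma modulus_midpoint_powR_le z w :
  2 * modulus (sinj k 2^-1 * (z + w)) `^ p <= modulus z `^ p + modulus w `^ p.
Proof.
have p0 : 0 <= p by rewrite ltW// (lt_trans ltr01).
apply: (@le_trans _ _ (2 * ((modulus z + modulus w) / 2) `^ p)).
  rewrite ler_wpM2l// ge0_ler_powR ?nnegrE ?modulus_ge0//.
    by rewrite divr_ge0// addr_ge0// modulus_ge0.
  by rewrite modulusM// mulrC ler_wpM2r// modulusD.
have [->|st] := eqVneq (modulus z) (modulus w).
  by rewrite half mulr_natl mulr2n.
by apply: ltW; apply: powR_midpoint_lt => //; exact: modulus_ge0.
Qed.

(** Strict convexity forces equal moduli. Equality in the triangle inequality then gives |z + w| = 2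
    |w|, and the parallelogram law leaves |z - w| = 0. *)
Lemma modulus_midpoint_powR_eq z w :
  2 * modulus (sinj k 2^-1 * (z + w)) `^ p = modulus z `^ p + modulus w `^ p ->
  z = w.
Proof.
have p0 : 0 < p by rewrite (lt_trans ltr01).
have mid_le : modulus (sinj k 2^-1 * (z + w)) <= (modulus z + modulus w) / 2.
  by rewrite modulusM// mulrC ler_wpM2r// modulusD.
have [st|st] := eqVneq (modulus z) (modulus w); last first.
  move=> e; have := powR_midpoint_lt p1 (modulus_ge0 z) (modulus_ge0 w) st.
  rewrite -e ltNge ler_wpM2l// ge0_ler_powR ?nnegrE ?modulus_ge0 ?(ltW p0)//.
  by rewrite divr_ge0// addr_ge0// modulus_ge0.
rewrite st => e.
have mid : modulus (sinj k 2^-1 * (z + w)) = modulus w.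
  apply/eqP; rewrite eq_le; move: mid_le; rewrite st half => -> /=.
  rewrite leNgt; apply/negP => lt.
  have := gt0_ltr_powR p0 _ _ lt; rewrite !nnegrE !modulus_ge0 => /(_ isT isT).
  by move=> /= ?; lra.
have := modulus_parallelogram z w.
have -> : modulus (z + w) = 2 * modulus w.
  by rewrite -mid modulusM//; field.
rewrite st => para; apply/eqP; rewrite -subr_eq0; apply/eqP/modulus0_eq0.
by apply/eqP; rewrite -sqrf_eq0; apply/eqP; move: para; rewrite exprMn; lra.
Qed.

End ModulusPowR.

(** Turns the eventual strict lower bounds supplied by lower semicontinuity into a bound on the
    limit inferior in Fatou's lemma. *)
Lemma lee_limn_einf (R : realType) (u : nat -> \bar R) (r : R) :
  (forall a : R, a < r -> \forall n \near \oo, (a%:E < u n)%E) ->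
  (r%:E <= limn_einf u)%E.
Proof.
move=> ur; apply/lee_subgt0Pr => e e0.
have [N _ NP] : \forall n \near \oo, ((r - e)%:E < u n)%E.
  by apply: ur; rewrite ltrBlDr ltrDl.
rewrite limn_einf_lim (cvg_lim _ (@cvg_einfs_sup _ u))//.
apply: le_trans (ereal_sup_ubound _); last by exists N.
by apply: le_ereal_inf_tmp => _ [n /= Nn <-]; apply/ltW/NP.
Qed.

(** * The RKHS as a real Hilbert space *)

Section RKHSReal.
Variables (R : realType) (k : scalar_kind) (X : Type) (H : rkhs R k X).
Local Notation V := (rkhs_space H).
Implicit Types u v w : V.

Definition rkhs_ip u v : R := sre (rkhs_dot H u v).
Definition rkhs_act (a : R) u : V := sinj k a *: u.

Lemma rkhs_ipDl u v w : rkhs_ip (u + v) w = rkhs_ip u w + rkhs_ip v w.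
Proof. by rewrite /rkhs_ip linearDl sreD. Qed.

Lemma rkhs_ipZl a u w : rkhs_ip (rkhs_act a u) w = a * rkhs_ip u w.
Proof. by rewrite /rkhs_ip linearZl_LR sreM. Qed.

Lemma rkhs_ipC u v : rkhs_ip u v = rkhs_ip v u.
Proof. by rewrite /rkhs_ip hermitian_subproof expr0 mul1r sre_conj. Qed.

Lemma rkhs_ip_ge0 u : 0 <= rkhs_ip u u.
Proof.
apply: sre_ge0; have [->|u0] := eqVneq u 0; first by rewrite linear0l.
by apply/ltW/neq0_dnorm_gt0.
Qed.

Lemma rkhs_norm_sqr u : rkhs_norm u ^+ 2 = rkhs_ip u u.
Proof. by rewrite sqr_sqrtr// rkhs_ip_ge0. Qed.

Lemma rkhs_norm_le u (M : R) :
  0 <= M -> (rkhs_norm u <= M) = (rkhs_ip u u <= M ^+ 2).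
Proof.
move=> M0; rewrite -rkhs_norm_sqr ler_pXn2r ?nnegrE//; exact: sqrtr_ge0.
Qed.

Lemma rkhs_ip_complete (u : nat -> V) :
  (forall e : R, 0 < e -> exists N : nat, forall m n : nat,
     (N <= m)%N -> (N <= n)%N -> rkhs_ip (u m - u n) (u m - u n) < e) ->
  exists l, rkhs_ip (u n - l) (u n - l) @[n --> \oo] --> (0 : R).
Proof.
move=> cu.
have [e e0|l ul] := @rkhs_complete _ _ _ H u.
  have [N NP] := cu (e ^+ 2) (exprn_gt0 2 e0).
  exists N => m n Nm Nn.
  rewrite -(ltr_pXn2r (ltn0Sn 1)) ?nnegrE ?(ltW e0) ?sqrtr_ge0//.
  by rewrite rkhs_norm_sqr; exact: NP.
exists l; under eq_fun do rewrite -rkhs_norm_sqr expr2.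
by rewrite -(mulr0 (0 : R)); exact: cvgM.
Qed.

Section Kernel.
Variable K : X -> X -> RorC R k.
Hypothesis K_kernel : reproducing_kernel H K.

Lemma rkhs_funD u v x : rkhs_fun (u + v) x = rkhs_fun u x + rkhs_fun v x.
Proof. by have [kx _ fx] := K_kernel x; rewrite !fx linearDl. Qed.

Lemma rkhs_funZ a u x : rkhs_fun (rkhs_act a u) x = sinj k a * rkhs_fun u x.
Proof. by have [kx _ fx] := K_kernel x; rewrite !fx linearZl_LR. Qed.

(** The real part of b f(x) is the real inner product of f with conj(b) k_x. Taking b = 1 and b =
    [simu] controls the real and imaginary parts of the values at [x]. *)
Lemma weak_cvg_modulus (u : nat -> V) l :
  (forall h, rkhs_ip (u n) h @[n --> \oo] --> rkhs_ip l h) ->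
  forall x, modulus (rkhs_fun l x - rkhs_fun (u n) x) @[n --> \oo] --> (0 : R).
Proof.
move=> ul x; have [kx _ fx] := K_kernel x.
have cv b :
    sre (b * (rkhs_fun l x - rkhs_fun (u n) x)) @[n --> \oo] --> (0 : R).
  have conjK (z : RorC R k) : sconj R k (sconj R k z) = z.
    by case: (k) z => //= -[? ?] /=; rewrite opprK.
  have E w : sre (b * rkhs_fun w x) = rkhs_ip w (sconj R k b *: kx).
    by rewrite /rkhs_ip linearZr_LR/= conjK fx.
  under eq_fun do rewrite mulrBr sreD sreN !E.
  rewrite -(subrr (rkhs_ip l (sconj R k b *: kx))).
  by apply: cvgB; [exact: cvg_cst|exact: ul].
have cv2 : `|sre (1 * (rkhs_fun l x - rkhs_fun (u n) x))| +
    `|sre (simu R k * (rkhs_fun l x - rkhs_fun (u n) x))| @[n --> \oo] --> (0 : R).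
  have -> : (0 : R) = `|0 : R| + `|0 : R| by rewrite normr0 addr0.
  by apply: cvgD; apply: cvg_norm; exact: cv.
apply: squeeze_cvgr (cvg_cst 0) cv2; apply: nearW => n.
by rewrite modulus_ge0 mul1r modulus_le.
Qed.

End Kernel.
End RKHSReal.

(** * Existence and uniqueness of the optimizer *)

Section Optimizer.
Variables (R : realType) (k : scalar_kind) (X : ptopologicalType).
Variables (H : rkhs R k X) (K : X -> X -> RorC R k).
Hypothesis K_kernel : reproducing_kernel H K.
Hypothesis H_meas : forall f : rkhs_space H, borel_measurable (rkhs_fun f).
Variables (mu : probability (borel X) R) (M : R) (M_gt0 : 0 < M).
Variables (g : X -> RorC R k) (g_meas : borel_measurable g).
Variables (c : RorC R k -> RorC R k -> R).
Hypothesis c_ge0 : forall z w, 0 <= c z w.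
Hypothesis c_meas : borel_measurable
  (fun zw : (RorC R k * RorC R k)%type => c zw.1 zw.2).

Let M0 : 0 <= M. Proof. exact: ltW. Qed.

Lemma loss_measurable (f : rkhs_space H) :
  measurable_fun setT
    ((fun x => (c (rkhs_fun f x) (g x))%:E) : borel X -> \bar R).
Proof.
have mfg := borel_measurable_pair (H_meas f) g_meas.
have mc : borel_measurable (fun x => c (rkhs_fun f x) (g x)) :=
  measurableT_comp c_meas mfg.
by apply/measurable_EFinP; exact: (borel_measurable_fun mc).
Qed.

Lemma optimizer_exists :
  (forall w, lower_semicontinuous (fun z => (c z w)%:E)) ->
  exists f : rkhs_space H, optimizer mu c g M f.
Proof.
move=> c_lsc; pose S := [set risk mu c g (rkhs_fun h) |
                 h in [set h : rkhs_space H | rkhs_norm h <= M]].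
have [|r rS rinf] := @ereal_inf_seq R S.
  apply/set0P; exists (risk mu c g (rkhs_fun (0 : rkhs_space H))), 0 => //=.
  by rewrite (rkhs_norm_le _ M0) (ip0l (@rkhs_ipDl _ _ _ H)) exprn_ge0.
have /choice[h hP] : forall n, exists h : rkhs_space H,
    rkhs_norm h <= M /\ risk mu c g (rkhs_fun h) = r n.
  by move=> n; have [h /= hM <-] := rS n; exists h.
have hM n : rkhs_ip (h n) (h n) <= M ^+ 2.
  by rewrite -(rkhs_norm_le _ M0); exact: (hP n).1.
have [s [l [sinc lM hl]]] := weak_sequential_compactness
  (@rkhs_ipDl _ _ _ H) (@rkhs_ipZl _ _ _ H) (@rkhs_ipC _ _ _ H)
  (@rkhs_ip_ge0 _ _ _ H) (@rkhs_ip_complete _ _ _ H) hM.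
have lM' : rkhs_norm l <= M by rewrite (rkhs_norm_le _ M0).
have s_ge n : (n <= s n)%N.
  by elim: n => // n IH; rewrite (leq_ltn_trans IH)// sinc.
have rs : r (s n) @[n --> \oo] --> ereal_inf S.
  apply: cvg_comp rinf => A [N _ NA]; exists N => // n /= Nn.
  by apply: NA => /=; rewrite (leq_trans Nn).
exists l; split=> //; apply/eqP; rewrite eq_le; apply/andP; split; last first.
  by apply: ereal_inf_lbound; exists l.
(* The infimum becomes the limit inferior of the risks along the subsequence, which Fatou's lemma
   bounds from below. *)
rewrite -/S -(cvg_lim _ rs)// -is_cvg_limn_einfE; last exact: cvgP rs.
rewrite [leRHS](_ : _ =
    limn_einf (fun n => risk mu c g (rkhs_fun (h (s n))))); last first.
  by congr limn_einf; apply/funext => n; rewrite (hP _).2.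
apply: le_trans (fatou _ _ _ _) => //; last 2 first.
- by move=> n; exact: loss_measurable.
- by move=> n x _; rewrite lee_fin.
apply: ge0_le_integral => //.
- by move=> x _; rewrite lee_fin.
- exact: loss_measurable.
- rewrite (_ : (fun x => _) = fun x : borel X => limn (einfs
      (fun n => (c (rkhs_fun (h (s n)) x) (g x))%:E))); last first.
    by apply/funext => x; rewrite limn_einf_lim.
  have me := measurable_fun_einfs (fun n => loss_measurable (h (s n))).
  apply: (@emeasurable_fun_cvg _ _ _ _ _ _ me).
  by move=> x _; exact: is_cvg_einfs.
move=> x _; apply: lee_limn_einf => a ac.
(* The cost exceeds [a] on a neighbourhood of [rkhs_fun l x], which the values of the subsequence at
   [x] eventually enter. *)
have [A /nbhs_modulusP[e e0 eA] Ac] := c_lsc (g x) (rkhs_fun l x) a ac.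
have /cvgrPdist_lt /(_ _ e0) := weak_cvg_modulus K_kernel hl x.
apply: filterS => n; rewrite sub0r normrN ger0_norm ?modulus_ge0// => lt.
exact/Ac/eA.
Qed.

Lemma optimizer_unique (p : R) :
  mu.-integrable setT (fun x => (c 0 (g x))%:E) ->
  1 < p -> (forall z w, c z w = modulus (z - w) `^ p) ->
  forall f1 f2 : rkhs_space H,
    optimizer mu c g M f1 -> optimizer mu c g M f2 ->
    {ae mu, forall x, rkhs_fun f1 x = rkhs_fun f2 x}.
Proof.
move=> c_int p1 cE f1 f2 [f1M f1opt] [f2M f2opt].
set S := [set risk mu c g (rkhs_fun h) |
                 h in [set h : rkhs_space H | rkhs_norm h <= M]] in f1opt f2opt.
have f00 x : rkhs_fun (0 : rkhs_space H) x = 0.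
  by have [kx _ fx] := K_kernel x; rewrite fx linear0l.
have inf_ge0 : (0 <= ereal_inf S)%E.
  apply: le_ereal_inf_tmp => _ [h _ <-].
  by apply: integral_ge0 => x _; rewrite lee_fin.
(* The zero function is admissible, and its risk is finite by [c_int]. *)
have inf_fin : ereal_inf S \is a fin_num.
  rewrite ge0_fin_numE//.
  apply: (@le_lt_trans _ _ (risk mu c g (rkhs_fun (0 : rkhs_space H)))).
    apply: ereal_inf_lbound; exists 0 => //=.
    by rewrite (rkhs_norm_le _ M0) (ip0l (@rkhs_ipDl _ _ _ H)) exprn_ge0.
  have /integrableP[_] := c_int; congr (_ < _)%E.
  by apply: eq_integral => x _; rewrite f00 /= ger0_norm.
pose m : rkhs_space H := rkhs_act 2^-1 (f1 + f2).
have mE x : rkhs_fun m x = sinj k 2^-1 * (rkhs_fun f1 x + rkhs_fun f2 x).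
  by rewrite (rkhs_funZ K_kernel) (rkhs_funD K_kernel).
have mM : rkhs_norm m <= M.
  move: f1M f2M; rewrite !(rkhs_norm_le _ M0).
  have Dr := ipDr (@rkhs_ipDl _ _ _ H) (@rkhs_ipC _ _ _ H).
  have Zr := ipZr (@rkhs_ipZl _ _ _ H) (@rkhs_ipC _ _ _ H).
  have := ip_double_le (@rkhs_ipDl _ _ _ H) (@rkhs_ipC _ _ _ H)
    (@rkhs_ip_ge0 _ _ _ H) f1 f2.
  rewrite /m rkhs_ipZl Zr rkhs_ipDl !Dr (rkhs_ipC f2 f1).
  by lra.
have ge_inf : (ereal_inf S <= risk mu c g (rkhs_fun m))%E.
  by apply: ereal_inf_lbound; exists m.
pose a x := c (rkhs_fun f1 x) (g x) + c (rkhs_fun f2 x) (g x).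
pose b x := 2 * c (rkhs_fun m x) (g x).
have midE x : rkhs_fun m x - g x =
    sinj k 2^-1 * ((rkhs_fun f1 x - g x) + (rkhs_fun f2 x - g x)).
  have half2 : sinj k 2^-1 * (2 : RorC R k) = 1.
    by case: (k) => /=;
      [rewrite mulVf|rewrite fmorphV rmorph_nat mulVf// pnatr_eq0].
  rewrite mE [in RHS]addrACA -opprD [in RHS]mulrDr mulrN; congr (_ - _).
  by rewrite -mulr2n -(mulr_natl (g x) 2) mulrA half2 mul1r.
have ba x : b x <= a x.
  by rewrite /a /b !cE midE; exact: modulus_midpoint_powR_le.
have ba_eq x : b x = a x -> rkhs_fun f1 x = rkhs_fun f2 x.
  by rewrite /a /b !cE midE => /(modulus_midpoint_powR_eq p1)/addIr.
(* The gap [d] is nonnegative and vanishes only where [f1] and [f2] agree, so a zero integral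
   suffices. *)
pose d x := a x - b x.
have mloss (f : rkhs_space H) :
    measurable_fun setT ((fun x => c (rkhs_fun f x) (g x)) : borel X -> R).
  exact: (measurable_EFinP _ _).1 (loss_measurable f).
have ma' := measurable_funD (mloss f1) (mloss f2).
have mb' := measurable_funM (@measurable_cst _ _ (borel X) R setT 2) (mloss m).
have ma : measurable_fun setT (EFin \o a : borel X -> \bar R).
  exact/measurable_EFinP.
have mb : measurable_fun setT (EFin \o b : borel X -> \bar R).
  exact/measurable_EFinP.
have md : measurable_fun setT (EFin \o d : borel X -> \bar R).
  by apply/measurable_EFinP; exact: (measurable_funB ma' mb').
have ia : (\int[mu]_x (a x)%:E = ereal_inf S + ereal_inf S)%E.
  rewrite -{1}f1opt -f2opt /risk -ge0_integralD//.
  - by move=> x _; rewrite lee_fin.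
  - exact: loss_measurable.
  - by move=> x _; rewrite lee_fin.
  - exact: loss_measurable.
have ib : (\int[mu]_x (b x)%:E = 2%:E * risk mu c g (rkhs_fun m))%E.
  rewrite /risk -ge0_integralZl_EFin//.
  - by move=> x _; rewrite lee_fin.
  - exact: loss_measurable.
have iabd : (\int[mu]_x (a x)%:E = \int[mu]_x (b x)%:E + \int[mu]_x (d x)%:E)%E.
  rewrite -ge0_integralD//.
  - by apply: eq_integral => x _; rewrite -EFinD /d addrC subrK.
  - by move=> x _; rewrite lee_fin mulr_ge0.
  - by move=> x _; rewrite lee_fin subr_ge0.
have id0 : (\int[mu]_x `|(d x)%:E| = 0)%E.
  have d_ge0 : (0 <= \int[mu]_x (d x)%:E)%E.
    by apply: integral_ge0 => x _; rewrite lee_fin subr_ge0.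
  have -> : (\int[mu]_x `|(d x)%:E| = \int[mu]_x (d x)%:E)%E.
    by apply: eq_integral => x _; rewrite gee0_abs// lee_fin subr_ge0.
  (* The integral of [a] is twice the infimum and that of [b] is at least as much. The infimum is
     finite, so the integral of [b] may be subtracted. *)
  apply/eqP; rewrite eq_le d_ge0 andbT.
  move: iabd; rewrite ia ib; move: ge_inf d_ge0 inf_fin.
  case: (ereal_inf S) => // i; case: (risk _ _ _ _) => // [j|]; last first.
    by rewrite mulry gtr0_sg// mul1e; case: (\int[mu]_x _)%E.
  case: (\int[mu]_x _)%E => // t.
  by rewrite !lee_fin => ij t0 _ []; lra.
have dae := (ae_eq_integral_abs mu measurableT md).1 id0.
apply: filterS dae => x /(_ I) [] d0; apply: ba_eq; apply/eqP.
by rewrite eq_sym -subr_eq0; apply/eqP.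
Qed.

End Optimizer.

Theorem proposition2p5
    (R : realType) (k : scalar_kind) (X : ptopologicalType)
    (X_polish : polish R X)
    (H : rkhs R k X) (K : X -> X -> RorC R k)
    (K_kernel : reproducing_kernel H K)
    (H_meas : forall f : rkhs_space H, borel_measurable (rkhs_fun f))
    (mu : probability (borel X) R) (M : R) (M_gt0 : 0 < M)
    (g : X -> RorC R k) (g_meas : borel_measurable g)
    (c : RorC R k -> RorC R k -> R)
    (c_ge0 : forall z w, 0 <= c z w)
    (c_meas : borel_measurable
       (fun zw : (RorC R k * RorC R k)%type => c zw.1 zw.2))
    (c_int : mu.-integrable setT (fun x => (c 0 (g x))%:E))
    (c_lsc : forall w, lower_semicontinuous (fun z => (c z w)%:E)) :
  (exists f : rkhs_space H, optimizer mu c g M f) /\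
  (forall p : R, 1 < p ->
     (forall z w, c z w = modulus (z - w) `^ p) ->
     forall f1 f2 : rkhs_space H,
       optimizer mu c g M f1 -> optimizer mu c g M f2 ->
       {ae mu, forall x, rkhs_fun f1 x = rkhs_fun f2 x}).
Proof.
split.
  exact (optimizer_exists K_kernel H_meas mu M_gt0 g_meas c_ge0 c_meas c_lsc).
move=> p p1 cE.
exact (optimizer_unique K_kernel H_meas M_gt0 g_meas c_ge0 c_meas c_int p1 cE).
Qed.
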